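(* Let $K=\bigcup_{\ell=1}^L[a_\ell,b_\ell]\subseteq[-1,1]$ be a finite union of closed intervals, with $-1\le a_1<b_1<a_2<b_2<\cdots<a_L<b_L\le1$, let $w$ be a positive continuous function on $K$, and let $N$ be a nonnegative integer. Let $\mathcal{U}_N^K$ be a weighted Chebyshev polynomial of the second kind for $K$, i.e. a minimizer of $\|P/w\|_{L_1(K)}$ over all monic real polynomials $P$ of degree $N$. Then $\mathcal{U}_N^K$ is the unique minimizer of $\|P/w\|_{L_1(K)}$ over all monic real polynomials $P$ of degree $N$ if and only if $\mathcal{U}_N^K$ has $N$ simple roots all lying inside $K$, i.e. in the interior $\bigcup_{\ell=1}^L(a_\ell,b_\ell)$ of $K$.
   Context: The weighted $L_1$-norm is $\|P/w\|_{L_1(K)}=\sum_{\ell=1}^L\int_{a_\ell}^{b_\ell}\frac{|P(t)|}{w(t)}\,dt$. *)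

(* Defs.v *)
From HB Require Import structures.
From mathcomp Require Import all_boot all_order all_algebra.
From mathcomp Require Import all_classical all_reals all_analysis.

Set Implicit Arguments.
Unset Strict Implicit.
Unset Printing Implicit Defensive.

Import Order.TTheory GRing.Theory Num.Theory.
Import numFieldNormedType.Exports.

Local Open Scope classical_set_scope.
Local Open Scope ring_scope.

(* -1 <= a_1 < b_1 < a_2 < ... < a_L < b_L <= 1; indices start at 0 here. *)
Definition interval_system (R : realType) (L : nat) (a b : 'I_L -> R) : Prop :=
  [/\ (0 < L)%N,
      forall l, -1 <= a l,
      forall l, a l < b l,
      forall l m : 'I_L, (l < m)%N -> b l < a m
    & forall l, b l <= 1].

Definition union_itvcc (R : realType) (L : nat) (a b : 'I_L -> R) : set R :=
  \bigcup_(l in [set: 'I_L]) `[a l, b l]%classic.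

Definition union_itvoo (R : realType) (L : nat) (a b : 'I_L -> R) : set R :=
  \bigcup_(l in [set: 'I_L]) `]a l, b l[%classic.

(* For w positive and continuous on the closed intervals the integrand is
   integrable, so taking real-valued integrals loses nothing. *)
Definition weighted_L1 (R : realType) (L : nat) (a b : 'I_L -> R) (w : R -> R)
    (P : {poly R}) : R :=
  \sum_(l < L) \int[lebesgue_measure]_(t in `[a l, b l]) (`|P.[t]| / w t).

Definition monic_of_degree (R : realType) (N : nat) (P : {poly R}) : Prop :=
  P \is monic /\ size P = N.+1.

Definition chebyshev_second_kind (R : realType) (L : nat) (a b : 'I_L -> R)
    (w : R -> R) (N : nat) (U : {poly R}) : Prop :=
  monic_of_degree N U /\
  forall P : {poly R}, monic_of_degree N P ->
    weighted_L1 a b w U <= weighted_L1 a b w P.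

Definition unique_chebyshev_second_kind (R : realType) (L : nat)
    (a b : 'I_L -> R) (w : R -> R) (N : nat) (U : {poly R}) : Prop :=
  chebyshev_second_kind a b w N U /\
  forall P : {poly R}, chebyshev_second_kind a b w N P -> P = U.

Definition has_simple_roots_in (R : realType) (N : nat) (D : set R)
    (U : {poly R}) : Prop :=
  exists s : seq R,
    [/\ size s = N, uniq s & forall x, x \in s -> mup x U = 1%N /\ D x].

(* Main.v *)
Require Import Defs.
From HB Require Import structures.
From mathcomp Require Import all_boot all_order all_algebra.
From mathcomp Require Import all_classical all_reals all_analysis.
From mathcomp Require Import lra.
From mathcomp Require polyrcf.

Set Implicit Arguments.
Unset Strict Implicit.
Unset Printing Implicit Defensive.

Import Order.TTheory GRing.Theory Num.Theory.
Import numFieldNormedType.Exports.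

Local Open Scope classical_set_scope.
Local Open Scope ring_scope.

(* For P monic of degree N, comparing U with U + (U - P) / c for large c shows
   that P is a minimizer as soon as P U >= 0 on K; conversely, by convexity, two
   minimizers U and P satisfy U P >= 0 in the interior of K. Hence U is the unique
   minimizer iff U is the only monic P of degree N with P U >= 0 on K. If U has N
   simple roots in the interior of K, each of them is a sign change of U, hence
   a root of P. Otherwise some factor of U can be modified without changing its
   sign on K: X - x with x not interior to K, by moving x slightly within the
   gap; (X - x)^2, by adding 1; a factor without real root, by adding a constant
   of the same sign. *)

(** * Factorization and monic polynomials of fixed degree *)

Lemma prod_XsubC_rootless (F : fieldType) (p : {poly F}) : p != 0 ->
  exists (s : seq F) (q : {poly F}),
    p = \prod_(x <- s) ('X - x%:P) * q /\ forall x, ~~ root q x.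
Proof.
have [n] := ubnP (size p); elim: n p => // n IHn p size_p p0.
have [[x px]|np] := pselect (exists x, root p x); last first.
  exists [::], p; rewrite big_nil mul1r; split=> // x.
  by apply/negP => px; apply: np; exists x.
have /factor_theorem[q pE] := px.
have q0 : q != 0 by apply: contra_neq p0 => q0; rewrite pE q0 mul0r.
have [|s [r [qE rN]]] := IHn q _ q0.
  by move: size_p; rewrite pE size_Mmonic ?monicXsubC// size_XsubC addn2.
by exists (x :: s), r; split=> //; rewrite big_cons pE qE mulrC mulrA.
Qed.

Lemma rootless_same_sign (R : rcfType) (p : {poly R}) (x y : R) :
  (forall z, ~~ root p z) -> 0 < p.[x] * p.[y].
Proof.
move=> pN.
wlog xy : x y / x <= y.
  by move=> H; have /orP[|] := le_total x y => /H//; rewrite mulrC.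
rewrite ltNge; apply/negP => /(polyrcf.poly_ivt xy)[z _ pz].
by have := pN z; rewrite pz.
Qed.

Lemma monic_of_degreeD (R : realType) (N : nat) (P Q : {poly R}) :
  monic_of_degree N P -> (size Q <= N)%N -> monic_of_degree N (P + Q).
Proof.
move=> [mP sP] sQ; have QP : (size Q < size P)%N by rewrite sP ltnS.
by split; [rewrite monicE lead_coefDl -?monicE | rewrite size_polyDl].
Qed.

Lemma size_monic_of_degreeB (R : realType) (N : nat) (P Q : {poly R}) :
  monic_of_degree N P -> monic_of_degree N Q -> (size (P - Q)%R <= N)%N.
Proof.
move=> [mP sP] [mQ sQ]; apply/leq_sizeP => j; rewrite leq_eqVlt => /predU1P[<-|Nj].
  (* Index [N] is that of both leading coefficients, which are 1 and cancel. *)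
  rewrite coefB -[N]/(N.+1.-1) -{1}sP -sQ -!lead_coefE (eqP mP).
  by rewrite (eqP mQ) subrr.
by rewrite coefB !nth_default ?subrr// ?sP ?sQ.
Qed.

(** Allows one monic factor of [U] to be exchanged for another of equal degree. *)
Lemma monic_of_degree_swap (R : realType) (N : nat) (p q r : {poly R}) :
  p \is monic -> q \is monic -> size q = size p ->
  monic_of_degree N (p * r) -> monic_of_degree N (q * r).
Proof.
move=> mp mq qp [mpr spr].
have mr : r \is monic by rewrite -(monicMl r mp).
split; first by rewrite monicMl.
by rewrite -spr !size_monicM ?monic_neq0// qp.
Qed.

Lemma monic_of_degree_roots (R : realType) (N : nat) (P : {poly R}) (s : seq R) :
  monic_of_degree N P -> size s = N -> uniq s -> all (root P) s ->
  P = \prod_(x <- s) ('X - x%:P).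
Proof.
move=> [mP sP] sN us rs; rewrite [LHS](all_roots_prod_XsubC _ rs).
- by rewrite (eqP mP) scale1r.
- by rewrite sP sN.
- by rewrite uniq_rootsE.
Qed.

(** * Gaps between the intervals and sign changes at a root *)

(** Finiteness of [I] gives one step [d] valid for all indices; it bounds how far a root may move
    inside a gap. *)
Lemma near_add_le (R : realType) (I : finType) (f : I -> R) (x : R) :
  exists2 d, 0 < d & forall i, x < f i -> x + d <= f i.
Proof.
have : \forall d \near 0^'+, forall i, x < f i -> x + d <= f i :> R.
  apply: filter_forall => i; have [xf|fx] := ltP x (f i); last exact: nearW.
  near=> d => _; rewrite -lerBrDl; near: d.
  by apply: nbhs_right_le; rewrite subr_gt0.
move=> H; have [d []] : exists d : R, 0 < d /\ forall i, x < f i -> x + d <= f i.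
  apply: (@filter_ex _ (0^'+ : set_system R)); near=> d; split; last exact: (near H).
  by near: d; exact: nbhs_right_gt.
by exists d.
Unshelve. all: by end_near. Qed.

Lemma gap_root_shift (R : realType) (L : nat) (a b : 'I_L -> R) (x : R) :
  interval_system a b -> ~ union_itvoo a b x ->
  exists2 y, y != x &
    forall t, union_itvcc a b t -> 0 <= (t - x) * (t - y).
Proof.
move=> [_ _ ab sep _] xN.
(* If some [l] fits, [x] is the right endpoint [b l] and moves right, stopping before the next left
   endpoint. Otherwise every interval lies in [t >= x] or strictly left of [x], and [x] moves
   left. *)
have [[l [alx xbl]]|nl] := pselect (exists l, a l < x /\ x <= b l).
  have {xbl} bx : b l = x.
    apply/eqP; rewrite eq_le xbl andbT leNgt; apply/negP => xb.
    by apply: xN; exists l => //=; rewrite in_itv/= alx.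
  have [d d0 hd] := near_add_le a x.
  exists (x + d); first by rewrite -subr_eq0 addrC addKr gt_eqF.
  move=> t [m _] /=; rewrite in_itv/= => /andP[amt tbm].
  have [lm|ml|lm] := ltngtP l m.
  - by have := hd m; rewrite -bx sep// => /(_ isT); rewrite bx => ?; nra.
  - by have := sep m l ml => ?; nra.
  - by move: tbm; rewrite -(val_inj lm) bx => ?; nra.
(* The sign reversal yields [b m <= x - d] for every [b m < x]. *)
have [d d0 hd] := near_add_le (fun m => - b m) (- x).
exists (x - d); first by rewrite -subr_eq0 addrC addKr oppr_eq0 gt_eqF.
move=> t [m _] /=; rewrite in_itv/= => /andP[amt tbm].
have [xa|ax] := leP x (a m); first by nra.
have bx : b m < x.
  by rewrite ltNge; apply/negP => xb; apply: nl; exists m.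
by have := hd m; rewrite ltrN2 bx => /(_ isT) ?; nra.
Qed.

(** If [P.[x]] were nonzero, [V * P] would keep a strict sign near [x] while [t - x] changes sign
    there. The points [x + e / 2] and [x - e / 2] then contradict each other. *)
Lemma root_of_sign (R : realType) (x u v : R) (V P : {poly R}) :
  u < x < v -> ~~ root V x ->
  (forall t, u < t < v -> 0 <= (t - x) * V.[t] * P.[t]) -> root P x.
Proof.
move=> /andP[ux xv] Vx sgn; apply/negP => /negP Px.
pose G := V * P.
have G0 : G.[x] != 0 by rewrite hornerM mulf_neq0// -rootE.
have near_sign : \forall t \near x, 0 < G.[x] * G.[t].
  have c : (fun t => G.[x] * G.[t]) @ x --> G.[x] * G.[x].
    by apply: cvgMl_tmp; exact: continuous_horner.
  apply: (cvgr_gt _ c); by rewrite -expr2 exprn_even_gt0.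
have near_in : \forall t \near x, u < t < v.
  have /near_in_itvoo : x \in `]u, v[ by rewrite in_itv/= ux.
  by apply: filterS => t; rewrite in_itv.
have /nbhs_ballP[e /= e0 He] : \forall t \near x, 0 < G.[x] * G.[t] /\ u < t < v.
  by near=> t; split; near: t.
have inb y : `|y| < e -> 0 < G.[x] * G.[x + y] /\ u < x + y < v.
  by move=> ye; apply: He; rewrite /ball/= opprD addNKr normrN.
have [p1 /sgn s1] : 0 < G.[x] * G.[x + e / 2] /\ u < x + e / 2 < v.
  by apply: inb; rewrite gtr0_norm; lra.
have [p2 /sgn s2] : 0 < G.[x] * G.[x + - (e / 2)] /\ u < x + - (e / 2) < v.
  by apply: inb; rewrite normrN gtr0_norm; lra.
rewrite -mulrA -hornerM -/G (addrC x) addrK in s1.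
rewrite -mulrA -hornerM -/G (addrC x) addrK in s2.
have : 0 <= G.[e / 2 + x] by rewrite -(pmulr_rge0 _ (_ : 0 < e / 2))//; lra.
have : G.[- (e / 2) + x] <= 0 by rewrite -(nmulr_rge0 _ (_ : - (e / 2) < 0))//; lra.
by rewrite !(addrC _ x); nra.
Unshelve. all: by end_near. Qed.

(** * Weighted integrals of continuous functions on a segment *)

Lemma continuous_itvcc_integrable (R : realType) (u v : R) (f : R -> R) :
  {within `[u, v], continuous f} ->
  (@lebesgue_measure R).-integrable `[u, v] (EFin \o f).
Proof.
by move=> cf; apply: continuous_compact_integrable => //; exact: segment_compact.
Qed.

(** If [f x > 0], continuity keeps [f] above [f x / 2] on a closed ball of radius [e] inside the
    open interval, so the integral is at least [e * f x > 0]. *)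
Lemma continuous_Rintegral_le0 (R : realType) (u v : R) (f : R -> R) :
  {within `[u, v], continuous f} ->
  (forall t, t \in `[u, v] -> 0 <= f t) ->
  \int[lebesgue_measure]_(t in `[u, v]) f t <= 0 ->
  forall t, t \in `]u, v[ -> f t = 0.
Proof.
move=> cf f0 If x xuv; apply/eqP/negPn/negP => fx0.
have fx : 0 < f x by rewrite lt_def fx0 f0// subset_itv_oo_cc.
have cfx : {for x, continuous f}.
  have co : {within `]u, v[, continuous f}.
    by apply: continuous_subspaceW cf; exact: subset_itv_oo_cc.
  move: co; rewrite continuous_open_subspace; last exact: interval_open.
  by apply; rewrite inE.
have /nbhs_closedballP[e He] : \forall t \near x, f x / 2 < f t /\ t \in `]u, v[.
  near=> t; split.
    near: t; apply: (cvgr_gt _ cfx); lra.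
  by near: t; exact: near_in_itvoo.
have e0 : 0 < e%:num by [].
have ballE := closed_ball_itv x e0.
have B y : `[x - e%:num, x + e%:num]%classic y -> f x / 2 < f y /\ y \in `]u, v[.
  by rewrite -ballE; exact: He.
have Buv : `[x - e%:num, x + e%:num] `<=` `[u, v]%classic.
  by move=> y /B[_]; exact: subset_itv_oo_cc.
have intf := continuous_itvcc_integrable cf.
move: If; apply/negP; rewrite -ltNge.
apply: (@lt_le_trans _ _
    (\int[lebesgue_measure]_(t in `[x - e%:num, x + e%:num]) (f x / 2))).
  rewrite Rintegral_cst//= lebesgue_measure_itv/= lte_fin.
  rewrite ifT; last lra.
  by rewrite /=; nra.
apply: (@le_trans _ _
    (\int[lebesgue_measure]_(t in `[x - e%:num, x + e%:num]) f t)).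
  apply: le_Rintegral => //.
  - apply: continuous_itvcc_integrable; apply: continuous_subspaceT => y.
    exact: cvg_cst.
  - exact: integrableS intf.
  - by move=> y /B[/ltW].
(* Monotonicity in the domain is applied to the extended-real integrals, both finite. *)
rewrite -lee_fin /Rintegral !fineK; last 2 first.
- exact: integrable_fin_num.
- apply: integrable_fin_num => //; exact: integrableS intf.
apply: ge0_subset_integral => //.
- exact: measurable_int intf.
Unshelve. all: by end_near. Qed.

Lemma continuous_div_within (R : realType) (A : set R) (f w : R -> R) :
  {within A, continuous w} -> (forall t, A t -> 0 < w t) -> continuous f ->
  {within A, continuous (fun t => f t / w t)}.
Proof.
move=> cw w0 cf; apply/subspace_continuousP => t At; apply: cvgM.
  by apply: cvg_within_filter; exact: cf.
apply: cvgV; first by rewrite gt_eqF// w0.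
by move/subspace_continuousP : cw; exact.
Qed.

Lemma continuous_div_integrable (R : realType) (u v : R) (f w : R -> R) :
  {within `[u, v], continuous w} -> (forall t, t \in `[u, v] -> 0 < w t) ->
  continuous f ->
  (@lebesgue_measure R).-integrable `[u, v] (EFin \o (fun t => f t / w t)).
Proof.
by move=> cw w0 cf; apply/continuous_itvcc_integrable/continuous_div_within.
Qed.

Lemma continuous_norm_horner (R : realType) (P : {poly R}) :
  continuous (fun t => `|P.[t]|).
Proof. by move=> t; apply: cvg_norm; exact: continuous_horner. Qed.

(** The positive part of [|P| - n |U|] is the error term when [P] is compared with the minimizer
    [U]. *)
Lemma continuous_truncated (R : realType) (U P : {poly R}) (n : nat) :
  continuous (fun t => Num.max (`|P.[t]| - n%:R * `|U.[t]|) 0).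
Proof.
move=> t; pose d t := `|P.[t]| - n%:R * `|U.[t]|.
apply: (@continuous_max R R d (cst 0)); last exact: cvg_cst.
apply: cvgB; first exact: continuous_norm_horner.
by apply: cvgMl_tmp; exact: continuous_norm_horner.
Qed.

Lemma continuous_lincomb (R : realType) (k m : R) (f g : R -> R) :
  continuous f -> continuous g -> continuous (fun t => k * f t + m * g t).
Proof.
by move=> cf cg t; apply: cvgD; apply: cvgMl_tmp; [exact: cf|exact: cg].
Qed.

Lemma Rintegral_div_lincomb (R : realType) (u v k m : R) (f g w : R -> R) :
  {within `[u, v], continuous w} -> (forall t, t \in `[u, v] -> 0 < w t) ->
  continuous f -> continuous g ->
  \int[lebesgue_measure]_(t in `[u, v]) ((k * f t + m * g t) / w t) =
  k * \int[lebesgue_measure]_(t in `[u, v]) (f t / w t) +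
  m * \int[lebesgue_measure]_(t in `[u, v]) (g t / w t).
Proof.
move=> cw w0 cf cg; have int h := @continuous_div_integrable _ _ _ h _ cw w0.
have intZ (n : R) (h : R -> R) : continuous h ->
    (@lebesgue_measure R).-integrable `[u, v] (EFin \o (fun t => n * (h t / w t))).
  move=> ch; have /int : continuous (fun t => n * h t).
    by move=> t; apply: cvgMl_tmp; exact: ch.
  by congr (integrable _ _ (EFin \o _)); apply/funext => t; rewrite mulrA.
rewrite -!RintegralZl//; [|exact: int|exact: int].
rewrite -RintegralD//; [|exact: intZ|exact: intZ].
by apply: eq_Rintegral => t _; rewrite mulrDl !mulrA.
Qed.

Lemma poly_roots_negligible (R : realType) (P : {poly R}) : P != 0 ->
  {ae (@lebesgue_measure R), forall t, P.[t] != 0}.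
Proof.
move=> P0; have [s Ps] : exists s : seq R, forall x, root P x -> x \in s.
  have [s [q [-> qN]]] := prod_XsubC_rootless P0.
  by exists s => x; rewrite rootM (negbTE (qN x)) orbF root_prod_XsubC.
exists [set` s]; split.
- apply: countable_measurable; first by move=> t; exact: measurable_set1.
  by apply: finite_set_countable; exact: finite_seq.
- apply: countable_lebesgue_measure0.
  by apply: finite_set_countable; exact: finite_seq.
- by move=> t /= /negP; rewrite negbK -rootE; exact: Ps.
Qed.

(** Dominated convergence with bound [|P| / w]: wherever [U.[t] != 0], hence almost everywhere, the
    integrand is 0 as soon as [n >= |P.[t]| / |U.[t]|]. *)
Lemma cvg_Rintegral_truncated (R : realType) (u v : R) (w : R -> R)
    (U P : {poly R}) :
  {within `[u, v], continuous w} -> (forall t, t \in `[u, v] -> 0 < w t) ->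
  U != 0 ->
  \int[lebesgue_measure]_(t in `[u, v])
    (Num.max (`|P.[t]| - n%:R * `|U.[t]|) 0 / w t) @[n --> \oo] --> (0 : R).
Proof.
move=> cw w0 U0.
have int f := @continuous_div_integrable _ _ _ f _ cw w0.
have intE n := int _ (@continuous_truncated _ U P n).
have intP := int _ (@continuous_norm_horner _ P).
have [||||_ _] := dominated_convergence (mu := @lebesgue_measure R)
    (D := `[u, v]%classic) (f := cst 0%E) _
    (fun n => measurable_int _ (intE n)) _ _ intP.
- by [].
- exact: measurable_cst.
- have := poly_roots_negligible U0.
  apply: filterS; first exact: (ae_filter_ringOfSetsType (@lebesgue_measure R)).
  move=> t Ut _.
  apply/cvg_EFin; first exact: nearW.
  apply: cvg_near_cst; near=> n => /=; rewrite max_r ?mul0r// subr_le0.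
  rewrite -ler_pdivrMr ?normr_gt0//; near: n; exact: nbhs_infty_ger.
- apply: aeW => t n /= tuv; rewrite lee_fin.
  have wt : 0 < w t by exact: w0.
  rewrite ger0_norm; last by rewrite divr_ge0 ?le_max ?lexx ?orbT// ltW.
  rewrite ler_pM2r ?invr_gt0// ge_max normr_ge0 andbT lerBlDr lerDl.
  by rewrite mulr_ge0.
by rewrite integral0 => /fine_cvg.
Unshelve. all: by end_near. Qed.

(** * Minimality and agreement of signs *)

Lemma weight_itv (R : realType) (L : nat) (a b : 'I_L -> R) (w : R -> R) (l : 'I_L) :
  {within union_itvcc a b, continuous w} ->
  (forall t, union_itvcc a b t -> 0 < w t) ->
  {within `[a l, b l], continuous w} /\ forall t, t \in `[a l, b l] -> 0 < w t.
Proof.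
move=> cw w0; have sub : `[a l, b l] `<=` union_itvcc a b by move=> t tl; exists l.
by split=> [|t /sub/w0//]; exact: continuous_subspaceW cw.
Qed.

(* Moving U away from P, to Q = U + (U - P) / c, cannot decrease the norm; as
   P and U have the same sign, c |Q| <= (c + 1) |U| - |P| + 2 (|P| - c |U|)^+,
   and the last term tends to 0 in norm when c -> oo. *)
Lemma same_sign_minimizer (R : realType) (L : nat) (a b : 'I_L -> R)
    (w : R -> R) (N : nat) (U P : {poly R}) :
  {within union_itvcc a b, continuous w} ->
  (forall t, union_itvcc a b t -> 0 < w t) ->
  chebyshev_second_kind a b w N U -> monic_of_degree N P ->
  (forall t, union_itvcc a b t -> 0 <= P.[t] * U.[t]) ->
  chebyshev_second_kind a b w N P.
Proof.
move=> cw w0 [mU Umin] mP PU; split=> // Q mQ; apply: le_trans (Umin _ mQ).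
have {Q mQ} U0 : U != 0 by apply: monic_neq0; have [] := mU.
pose E n := \sum_(l < L) \int[lebesgue_measure]_(t in `[a l, b l])
  (Num.max (`|P.[t]| - n%:R * `|U.[t]|) 0 / w t).
have E0 : E n @[n --> \oo] --> (0 : R).
  rewrite -(@big1_eq _ 0 +%R 'I_L (index_enum _) xpredT).
  apply: cvg_big => [|l _]; first exact: add_continuous.
  have [cl wl] := weight_itv l cw w0.
  exact: cvg_Rintegral_truncated.
(* The shift to [n.+1] makes the constant [c] below invertible. *)
suff H n : weighted_L1 a b w P - weighted_L1 a b w U <= 2 * E n.+1.
  have E20 : 2 * E n.+1 @[n --> \oo] --> (2 * 0 : R).
    by apply: cvgMl_tmp; rewrite (cvg_shiftS E).
  by rewrite -subr_le0 -(mulr0 2); apply: (cvgr_to_ge E20); exact: nearW.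
pose c : R := n.+1%:R; have c0 : 0 < c by rewrite ltr0n.
pose Q := U + c^-1 *: (U - P).
have mQ : monic_of_degree N Q.
  apply: monic_of_degreeD => //; apply: leq_trans (size_scale_leq _ _) _.
  exact: size_monic_of_degreeB.
have := Umin _ mQ; rewrite -(ler_pM2l c0) => UQ.
(* Minimality of [U] bounds the first term below by [c] times the norm of [U]. The factor [1] fits
   the form of [Rintegral_div_lincomb]. *)
suff : c * weighted_L1 a b w Q + 1 * weighted_L1 a b w P <=
   (c + 1) * weighted_L1 a b w U + 2 * E n.+1 by lra.
rewrite /weighted_L1 /E !mulr_sumr -!big_split/=; apply: ler_sum => l _.
have [cl wl] := weight_itv l cw w0.
have cn p := @continuous_norm_horner _ p.
have cE := @continuous_truncated _ U P n.+1.
rewrite -!Rintegral_div_lincomb//; apply: le_Rintegral => //.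
- by apply: continuous_div_integrable => //; exact: continuous_lincomb.
- by apply: continuous_div_integrable => //; exact: continuous_lincomb.
move=> t tl; have wt : 0 < w t by exact: wl.
rewrite mul1r ler_pM2r ?invr_gt0//.
have {}PU : 0 <= P.[t] * U.[t] by apply: PU; exists l.
have -> : c * `|Q.[t]| = `|(c + 1) * U.[t] - P.[t]|.
  rewrite -[X in X * _](gtr0_norm c0) -normrM; congr `|_|.
  rewrite !hornerE mulrDr mulrA divff ?gt_eqF// mul1r; lra.
rewrite -[n.+1%:R]/c.
set u := U.[t] in PU *; set p := P.[t] in PU *.
set m := Num.max _ _.
have m0 : 0 <= m by rewrite le_max lexx orbT.
have mc : `|p| - c * `|u| <= m by rewrite le_max lexx.
have uc : 0 <= c * `|u| by rewrite mulr_ge0// ltW.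
rewrite -lerBrDr ler_norml; move: mc uc.
have [u0|u0] := ger0P u; have [p0|p0] := ger0P p => mc uc; apply/andP; split; nra.
Qed.

(** The midpoint [Q] of [U] and [P] is a competitor, so [|U| + |P| - 2 |Q|], nonnegative by the
    triangle inequality, has weighted integral at most 0. It vanishes on the open intervals, and
    equality in the triangle inequality means that the signs agree. *)
Lemma minimizers_same_sign (R : realType) (L : nat) (a b : 'I_L -> R)
    (w : R -> R) (N : nat) (U P : {poly R}) :
  {within union_itvcc a b, continuous w} ->
  (forall t, union_itvcc a b t -> 0 < w t) ->
  chebyshev_second_kind a b w N U -> chebyshev_second_kind a b w N P ->
  forall t, union_itvoo a b t -> 0 <= U.[t] * P.[t].
Proof.
move=> cw w0 [mU Umin] [mP Pmin].
pose Q := U + 2^-1 *: (P - U).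
have mQ : monic_of_degree N Q.
  apply: monic_of_degreeD => //; apply: leq_trans (size_scale_leq _ _) _.
  exact: size_monic_of_degreeB.
have QE t : 2 * Q.[t] = U.[t] + P.[t] by rewrite !hornerE; lra.
pose h t := `|U.[t]| + `|P.[t]| - 2 * `|Q.[t]|.
have h0 t : 0 <= h t.
  rewrite subr_ge0 -[X in X * _]ger0_norm// -normrM QE; exact: ler_normD.
have ch : continuous h.
  move=> t; apply: cvgB; last by apply: cvgMl_tmp; exact: continuous_norm_horner.
  by apply: cvgD; exact: continuous_norm_horner.
pose I l := \int[lebesgue_measure]_(t in `[a l, b l]) (h t / w t).
have I0 l : 0 <= I l.
  have [cl wl] := weight_itv l cw w0.
  by apply: Rintegral_ge0 => t /wl wt; rewrite divr_ge0// ltW.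
have sumI : \sum_l I l <= 0.
  suff -> : \sum_l I l = weighted_L1 a b w U + weighted_L1 a b w P -
      2 * weighted_L1 a b w Q.
    by have := Umin _ mQ; have := Pmin _ mQ; lra.
  rewrite /weighted_L1 mulr_sumr -big_split -sumrB; apply: eq_bigr => l _ /=.
  have [cl wl] := weight_itv l cw w0.
  have cn p := @continuous_norm_horner _ p.
  rewrite -[X in X + _ - _]mul1r -[X in _ + X - _]mul1r -mulNr.
  rewrite -Rintegral_div_lincomb// -[X in X + _]mul1r -Rintegral_div_lincomb//.
    by apply: eq_Rintegral => t _; rewrite !mul1r mulNr.
  exact: continuous_lincomb.
move=> t [l _ tl]; have [cl wl] := weight_itv l cw w0.
have {}I0 : I l <= 0.
  apply: le_trans sumI; rewrite (bigD1 l)//= lerDl; exact: sumr_ge0.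
have /eqP : h t / w t = 0.
  apply: (@continuous_Rintegral_le0 _ (a l) (b l) (fun t => h t / w t)) => //.
    exact: continuous_div_within.
  by move=> y /wl wy; rewrite divr_ge0// ltW.
rewrite mulf_eq0 invr_eq0 (gt_eqF (wl t _)) ?orbF; last exact: subset_itv_oo_cc.
rewrite subr_eq0 -[X in X * _]ger0_norm// -normrM QE => /eqP.
set u := U.[t]; set p := P.[t].
have [u0|u0] := ger0P u; have [p0|p0] := ger0P p;
  have [q0|q0] := ger0P (u + p) => *; nra.
Qed.

(** * Rigidity under sign agreement forces simple interior roots *)

Section Unique.
Variables (R : realType) (L : nat) (a b : 'I_L -> R) (w : R -> R) (N : nat).
Variable U : {poly R}.
Hypothesis hab : interval_system a b.
Hypothesis mU : monic_of_degree N U.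
Hypothesis rigid : forall P, monic_of_degree N P ->
  (forall t, union_itvcc a b t -> 0 <= P.[t] * U.[t]) -> P = U.

(** The product of [q * r] and [U = p * r] is [q * p * r ^+ 2], so [rigid] applies to [q * r]; then
    [r != 0] is cancelled. *)
Lemma rigid_cofactor (p q r : {poly R}) : U = p * r ->
  p \is monic -> q \is monic -> size q = size p ->
  (forall t, union_itvcc a b t -> 0 <= q.[t] * p.[t]) -> q = p.
Proof.
move=> UE mp mq qp pos; apply: (@mulIf _ r).
  apply: contraTneq (proj1 mU) => r0.
  by rewrite UE r0 mulr0 monicE lead_coef0 eq_sym oner_eq0.
rewrite -UE; apply: rigid.
  by apply: (monic_of_degree_swap mp mq qp); rewrite -UE.
by move=> t /pos ?; rewrite UE !hornerM mulrACA mulr_ge0// -expr2 sqr_ge0.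
Qed.

Lemma rigid_root_in x : root U x -> union_itvoo a b x.
Proof.
move=> /factor_theorem[q UE]; apply: contrapT => /(gap_root_shift hab)[y yx pos].
have /(congr1 (horner^~ y)) : 'X - y%:P = 'X - x%:P.
  apply: (@rigid_cofactor _ _ q); rewrite ?monicXsubC ?size_XsubC// 1?mulrC//.
  by move=> t /pos; rewrite !hornerXsubC mulrC.
by rewrite !hornerXsubC subrr => /esym/eqP; rewrite subr_eq0 (negbTE yx).
Qed.

Lemma rigid_no_square x : ~~ (('X - x%:P) ^+ 2 %| U).
Proof.
apply/negP => /dvdpP[q UE]; set p := ('X - x%:P) ^+ 2 in UE *.
have sp : size p = 3%N by rewrite size_exp_XsubC.
suff /eqP : p + 1 = p by rewrite -subr_eq0 addrC addKr oner_eq0.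
have mp : p \is monic by rewrite monic_exp// monicXsubC.
apply: (@rigid_cofactor _ _ q) => //; first by rewrite mulrC.
- by rewrite monicE lead_coefDl ?sp ?size_poly1.
- by rewrite size_polyDl ?sp ?size_poly1.
- move=> t _; have pt : 0 <= p.[t] by rewrite horner_exp sqr_ge0.
  by rewrite hornerD hornerC mulr_ge0// addr_ge0.
Qed.

Lemma rigid_simple_roots : has_simple_roots_in N (union_itvoo a b) U.
Proof.
have U0 : U != 0 by apply: monic_neq0; have [] := mU.
have [s [q [UE qN]]] := prod_XsubC_rootless U0.
set p := \prod_(x <- s) ('X - x%:P) in UE.
have mp : p \is monic by exact: monic_prod_XsubC.
have mq : q \is monic by rewrite -(monicMl q mp) -UE; have [] := mU.
have q1 : q = 1.
  apply/eqP/negPn/negP => q1.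
  have sq : (1 < size q)%N.
    rewrite ltnNge; apply: contra q1 => /size1_polyC qc.
    by move: mq; rewrite qc monicE lead_coefC => /eqP->.
  (* Without roots, [q] keeps on the whole line the sign it has at 0, so adding this sign does not
     change it. *)
  pose e := Num.sg q.[0].
  have e0 : e != 0 by rewrite sgr_eq0 -rootE.
  have /eqP : q + e%:P = q.
    have se : (size e%:P < size q)%N by apply: leq_ltn_trans sq; exact: size_polyC_leq1.
    apply: (@rigid_cofactor _ _ p); rewrite ?size_polyDl// 1?mulrC//.
      by rewrite monicE lead_coefDl.
    move=> t _; rewrite !hornerE.
    have := rootless_same_sign 0 t qN; rewrite /e.
    by case: (sgrP q.[0]) => ? ?; nra.
  by rewrite -subr_eq0 addrC addKr polyC_eq0 (negbTE e0).
rewrite q1 mulr1 in UE.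
(* A double root is excluded by [rigid_no_square]. Since the multiplicity of [x] in [U] counts its
   occurrences in [s], this also makes [s] duplicate-free. *)
have m1 x : x \in s -> mup x U = 1%N.
  move=> xs; apply/eqP; rewrite eqn_leq mup_leq// rigid_no_square/=.
  by rewrite -XsubC_dvd// dvdp_XsubCl UE root_prod_XsubC.
exists s; split.
- by have [_] := mU; rewrite UE size_prod_XsubC => -[].
- apply: count_mem_uniq => x; rewrite -mu_prod_XsubC -/p -UE.
  case: (boolP (x \in s)) => [/m1//|xs].
  by rewrite mupNroot// UE root_prod_XsubC.
- move=> x xs; split; first exact: m1.
  by apply: rigid_root_in; rewrite UE root_prod_XsubC.
Qed.

End Unique.

(** * From simple interior roots to uniqueness, and the equivalence *)

(** At a simple root [x], [U] is [X - x] times a factor [V] nonzero at [x], so [root_of_sign] makes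
    [x] a root of [P]. Both monic polynomials then have the same [N] distinct roots. *)
Lemma same_sign_simple_roots (R : realType) (L : nat) (a b : 'I_L -> R) (N : nat)
    (U P : {poly R}) :
  monic_of_degree N U -> monic_of_degree N P ->
  has_simple_roots_in N (union_itvoo a b) U ->
  (forall t, union_itvoo a b t -> 0 <= U.[t] * P.[t]) -> P = U.
Proof.
move=> mU mP [s [sN us rs]] pos.
have U0 : U != 0 by apply: monic_neq0; have [] := mU.
have Us : all (root U) s.
  by apply/allP => x /rs[m1 _]; rewrite -dvdp_XsubCl XsubC_dvd// m1.
rewrite (monic_of_degree_roots mU sN us Us).
apply: monic_of_degree_roots mP sN us _.
apply/allP => x xs; have [m1 [l _ xl]] := rs x xs.
have /factor_theorem[V UE] := allP Us x xs.
apply: (@root_of_sign _ x (a l) (b l) V) => //.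
- apply/negP => /factor_theorem[W VE].
  suff : (2 <= mup x U)%N by rewrite m1.
  by rewrite mup_geq// UE VE -mulrA -expr2 dvdp_mull.
- move=> t tl; have : 0 <= U.[t] * P.[t] by apply: pos; exists l.
  by rewrite UE hornerM hornerXsubC (mulrC V.[t]).
Qed.

Theorem proposition7 (R : realType) (L : nat) (a b : 'I_L -> R)
  (hab : interval_system a b) (w : R -> R)
  (w_cont : {within union_itvcc a b, continuous w})
  (w_pos : forall t, union_itvcc a b t -> 0 < w t)
  (N : nat) (U : {poly R}) (hU : chebyshev_second_kind a b w N U) :
  unique_chebyshev_second_kind a b w N U <->
  has_simple_roots_in N (union_itvoo a b) U.
Proof.
have [mU _] := hU; split=> [[_ U_uniq]|roots].
  (* Rigidity holds because a monic [P] agreeing in sign with [U] is again a minimizer. *)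
  apply: rigid_simple_roots => // P mP PU.
  apply: U_uniq; exact: same_sign_minimizer hU mP PU.
split=> // P hP; have [mP _] := hP.
apply: same_sign_simple_roots mU mP roots _.
exact: minimizers_same_sign hU hP.
Qed.
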